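(* Let $(\mathbf X_1,\mathbf Y_1)$ and $(\mathbf X_2,\mathbf Y_2)$ be general correlated sources, both uniformly integrable, and let $(\mathbf X,\mathbf Y)$ be their mixture $P_{X^nY^n}=\alpha_1P_{X_1^nY_1^n}+\alpha_2P_{X_2^nY_2^n}$ with constants $\alpha_1,\alpha_2>0$, $\alpha_1+\alpha_2=1$. Assume $\underline D(\mathbf X_1\Vert\mathbf X_2)>0$ and $\underline D(\mathbf X_2\Vert\mathbf X_1)>0$. Then \[\overline H_s(\mathbf X|\mathbf Y)=\lim_{\varepsilon\downarrow0}\limsup_{n\to\infty}\sum_{i=1,2}\frac{\alpha_i}{n}\overline H_s^\varepsilon(X_i^n|Y_i^n).\]
   Context: A general correlated source $\{(X^n,Y^n)\}_{n\ge1}$ is an arbitrary sequence of pairs of random variables on $\mathcal X^n\times\mathcal Y^n$, $\mathcal X,\mathcal Y$ finite or countably infinite (no structural assumptions; marginal probabilities positive). Logs base 2. A source is uniformly integrable if $Z_n=\frac1n\log\frac1{P_{X^n|Y^n}(X^n|Y^n)}$ satisfies $\lim_{u\to\infty}\sup_n\sum_{z:|z|\ge u}P_{Z_n}(z)|z|=0$. Spectral inf-divergence rate: $\underline D(\mathbf X_1\Vert\mathbf X_2)=\sup\{\beta:\lim_n\Pr\{\frac1n\log\frac{P_{X_1^n}(X_1^n)}{P_{X_2^n}(X_1^n)}<\beta\}=0\}$, where $X_1^n\sim P_{X_1^n}$ and $P_{X_i^n}$ are the $\mathcal X^n$-marginals. For a source with distributions $P_{X^nY^n}$, $x^n$ and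 $\varepsilon\in(0,1]$: $\overline h^\varepsilon(x^n|P_{X^nY^n})=\inf\{a\in\mathbb R:\sum_{y^n:\log(1/P_{X^n|Y^n}(x^n|y^n))>a}P_{Y^n|X^n}(y^n|x^n)\le\varepsilon\}$; $\overline H_s^\varepsilon(X^n|Y^n)=\sum_{x^n}P_{X^n}(x^n)\overline h^\varepsilon(x^n|P_{X^nY^n})$ (analogously for $(X_i^n,Y_i^n)$); $\overline H_s(\mathbf X|\mathbf Y)=\lim_{\varepsilon\downarrow0}\limsup_n\frac1n\overline H_s^\varepsilon(X^n|Y^n)$. *)

(* Defs.v *)
From HB Require Import structures.
From mathcomp Require Import all_boot all_order all_algebra.
From mathcomp Require Import all_classical all_reals all_analysis.
Set Implicit Arguments. Unset Strict Implicit. Unset Printing Implicit Defensive.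
Import Order.TTheory GRing.Theory Num.Theory.
Import numFieldNormedType.Exports.
Local Open Scope classical_set_scope.
Local Open Scope ring_scope.

Section Defs.
Variables (R : realType) (X Y : countType).

Definition source := forall n : nat, n.-tuple X * n.-tuple Y -> R.

Definition log2 (t : R) : R := ln t / ln 2.

Definition esum_signed (T : choiceType) (f : T -> \bar R) : \bar R :=
  (\esum_(t in [set: T]) (f^\+ t) - \esum_(t in [set: T]) (f^\- t))%E.

Definition margX (P : source) n (x : n.-tuple X) : R :=
  fine (\esum_(y in [set: n.-tuple Y]) (P n (x, y))%:E).
Definition margY (P : source) n (y : n.-tuple Y) : R :=
  fine (\esum_(x in [set: n.-tuple X]) (P n (x, y))%:E).

Definition is_source (P : source) : Prop :=
  forall n, (forall xy, 0 <= P n xy) /\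
    (\esum_(xy in [set: n.-tuple X * n.-tuple Y]) (P n xy)%:E = 1)%E /\
    (forall x : n.-tuple X, 0 < margX P x) /\ (forall y : n.-tuple Y, 0 < margY P y).

Definition condXY (P : source) n (x : n.-tuple X) (y : n.-tuple Y) : R :=
  P n (x, y) / margY P y.
Definition condYX (P : source) n (x : n.-tuple X) (y : n.-tuple Y) : R :=
  P n (x, y) / margX P x.

Definition Zn (P : source) n (xy : n.-tuple X * n.-tuple Y) : R :=
  n%:R^-1 * log2 (condXY P xy.1 xy.2)^-1.

(* distribution of Z_n (pairs of zero probability carry no mass) *)
Definition PZ (P : source) n (z : R) : \bar R :=
  \esum_(xy in [set xy | 0 < P n xy /\ Zn P xy = z]) (P n xy)%:E.

Definition uniformly_integrable (P : source) : Prop :=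
  (fun u : R => ereal_sup (range (fun n : nat =>
      \esum_(z in [set z : R | u <= `|z|]) (PZ P n z * (`|z|)%:E)%E)))
    @ +oo --> (0 : \bar R).

Definition Pr_div (P1 P2 : source) (beta : R) n : \bar R :=
  \esum_(x in [set x : n.-tuple X | 0 < margX P1 x /\
          n%:R^-1 * log2 (margX P1 x / margX P2 x) < beta]) (margX P1 x)%:E.

Definition Dinf (P1 P2 : source) : \bar R :=
  ereal_sup [set beta%:E | beta in [set beta : R |
     Pr_div P1 P2 beta @ \oo --> (0 : \bar R)]].

Definition hbar (P : source) (eps : R) n (x : n.-tuple X) : \bar R :=
  ereal_inf [set a%:E | a in [set a : R |
     (\esum_(y in [set y : n.-tuple Y | (0 < P n (x, y))%R /\
                       (log2 (condXY P x y)^-1 > a)%R]) (condYX P x y)%:E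
       <= eps%:E)%E]].

Definition Hs_eps (P : source) (eps : R) n : \bar R :=
  esum_signed (fun x : n.-tuple X => ((margX P x)%:E * hbar P eps x)%E).

Definition Hs (P : source) : \bar R :=
  lim ((limn_esup (fun n : nat => ((n%:R^-1)%:E * Hs_eps P eps n)%E))
        @[eps --> 0^'+]).

Definition mixture (a1 a2 : R) (P1 P2 : source) : source :=
  fun n xy => a1 * P1 n xy + a2 * P2 n xy.

End Defs.

(* Main.v *)
Require Import Defs.
From HB Require Import structures.
From mathcomp Require Import all_boot all_order all_algebra.
From mathcomp Require Import all_classical all_reals all_analysis.
From mathcomp Require Import ring lra.
Import Order.TTheory GRing.Theory Num.Theory.
Import numFieldNormedType.Exports.
Local Open Scope classical_set_scope.
Local Open Scope ring_scope.

(** Write J and J_i for the conditional information densities of the mixture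
    and of its components.  Positivity of the spectral inf-divergence rates
    makes the x-marginal of one component dominate the other on a set of x of
    probability close to 1 under the former.  For such x, and for all y
    outside a set of small conditional probability, J and J_i differ by at
    most a constant, so the epsilon-quantiles of J and J_i given x agree up to
    that constant and a small change of epsilon.  On the remaining x, the
    quantile is bounded by Markov's inequality, and uniform integrability
    makes the resulting contribution negligible.  Each side of the claim at
    level 2 epsilon is thus bounded by the other side at level epsilon, and
    both are monotone in epsilon. *)

(** * Sums over countable types and marginals *)

Section esum_extra.
Context (R : realType).
Local Open Scope ereal_scope.

(** Finite partial sums give [<=] for every nonnegative constant; the same bound with [c^-1],
    applied to the scaled family, gives the converse when [c] is positive. *)
Lemma esumZl (T : choiceType) (A : set T) (c : R) (f : T -> \bar R) :
  (0 <= c)%R -> (forall x, 0 <= f x) ->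
  \esum_(x in A) (c%:E * f x) = c%:E * \esum_(x in A) f x.
Proof.
have le_esumZl (d : R) (g : T -> \bar R) : (0 <= d)%R ->
    (forall x, 0 <= g x) ->
    \esum_(x in A) (d%:E * g x) <= d%:E * \esum_(x in A) g x.
  move=> d0 g0; apply: ge_ereal_sup => _ [F FA <-].
  rewrite -ge0_mule_fsumr//; apply: lee_wpmul2l; first by rewrite lee_fin.
  by apply: ereal_sup_ubound; exists F.
move=> c0 f0; apply/eqP; rewrite eq_le le_esumZl//=.
have [->|cN0] := eqVneq c 0%R.
  by rewrite mul0e; apply: esum_ge0 => x _; rewrite mul0e.
have {}c0 : (0 < c)%R by rewrite lt_neqAle eq_sym cN0.
have ci0 : (0 < c^-1)%R by rewrite invr_gt0.
have cf0 x : 0 <= c%:E * f x by rewrite mule_ge0// lee_fin ltW.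
have := le_esumZl c^-1%R (fun x => c%:E * f x) (ltW ci0) cf0.
rewrite lee_pdivlMl//; apply: le_trans.
apply: lee_wpmul2l; first by rewrite lee_fin ltW.
by apply: le_esum => x _; rewrite muleA -EFinM mulVf ?mul1e.
Qed.

Lemma subset_esum (T : choiceType) (A B : set T) (f : T -> \bar R) :
  A `<=` B -> \esum_(x in A) f x <= \esum_(x in B) f x.
Proof.
move=> AB; apply: ge_ereal_sup => _ [F [finF FA] <-].
by apply: ereal_sup_ubound; exists F => //; split => //; exact: subset_trans AB.
Qed.

Lemma esumU_le (T : choiceType) (A B : set T) (f : T -> \bar R) :
  (forall x, 0 <= f x) ->
  \esum_(x in A `|` B) f x <= \esum_(x in A) f x + \esum_(x in B) f x.
Proof.
move=> f0; rewrite (esumID A)// leeD//; apply: subset_esum.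
  by move=> x [].
by move=> x [[|//] Ax /(_ Ax)].
Qed.

Lemma esum_ge1 (T : choiceType) (A : set T) (f : T -> \bar R) x :
  A x -> 0 <= f x -> f x <= \esum_(t in A) f t.
Proof.
move=> Ax fx0; rewrite -[leLHS](@esum_set1 _ _ x f)//.
by apply: subset_esum => _ ->.
Qed.

Lemma esum_pair (T U : choiceType) (A : set T) (f : T -> U -> \bar R) :
  (forall x y, 0 <= f x y) ->
  \esum_(x in A) \esum_(y in [set: U]) f x y =
  \esum_(z in [set z | A z.1]) f z.1 z.2.
Proof.
move=> f0; rewrite esum_esum//; congr esum.
by apply/seteqP; split => [z []|z Az].
Qed.

Lemma esum_swap (T U : choiceType) (f : T -> U -> \bar R) :
  (forall x y, 0 <= f x y) ->
  \esum_(x in [set: T]) \esum_(y in [set: U]) f x y =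
  \esum_(y in [set: U]) \esum_(x in [set: T]) f x y.
Proof.
move=> f0; rewrite !esum_pair//.
apply: (@reindex_esum _ _ _ _ _ (fun z : U * T => (z.2, z.1))
  (fun z => f z.1 z.2)).
split => //; first by move=> [? ?] [? ?] _ _ [-> ->].
by move=> [x y] _; exists (y, x).
Qed.

End esum_extra.

Section source_facts.
Context (R : realType) (X Y : countType) (P : source R X Y) (n : nat).
Hypothesis srcP : is_source P.
Local Notation A := (n.-tuple X).
Local Notation B := (n.-tuple Y).

Let src_ge0 z : 0 <= P n z. Proof. by have [+ _] := srcP n; apply. Qed.

Let esum_src :
  (\esum_(x in [set: A]) \esum_(y in [set: B]) (P n (x, y))%:E = 1)%E.
Proof.
rewrite esum_pair => [|x y]; last by rewrite lee_fin.
have [_ [+ _]] := srcP n; move=> <-.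
by apply: eq_esum => -[].
Qed.

Lemma margX_gt0 (x : A) : 0 < margX P x.
Proof. by have [_ [_ [+ _]]] := srcP n; apply. Qed.

Lemma margY_gt0 (y : B) : 0 < margY P y.
Proof. by have [_ [_ [_ +]]] := srcP n; apply. Qed.

(** [margX] is defined through [fine]; the total mass 1 bounds each row sum, so nothing is lost by
    the conversion. *)
Lemma esum_row (x : A) :
  (\esum_(y in [set: B]) (P n (x, y))%:E = (margX P x)%:E)%E.
Proof.
rewrite /margX fineK// ge0_fin_numE; last by apply: esum_ge0 => y _; rewrite lee_fin.
apply: (@le_lt_trans _ _ 1%E); last exact: ltry.
rewrite -esum_src.
apply: (@esum_ge1 _ _ setT (fun x => \esum_(y in [set: B]) (P n (x, y))%:E)%E) => //.
by apply: esum_ge0 => y _; rewrite lee_fin.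
Qed.

Lemma esum_col (y : B) :
  (\esum_(x in [set: A]) (P n (x, y))%:E = (margY P y)%:E)%E.
Proof.
rewrite /margY fineK// ge0_fin_numE; last by apply: esum_ge0 => x _; rewrite lee_fin.
apply: (@le_lt_trans _ _ 1%E); last exact: ltry.
rewrite -esum_src esum_swap => [|x' y']; last by rewrite lee_fin.
apply: (@esum_ge1 _ _ setT (fun y => \esum_(x in [set: A]) (P n (x, y))%:E)%E) => //.
by apply: esum_ge0 => x _; rewrite lee_fin.
Qed.

Lemma esum_margX : (\esum_(x in [set: A]) (margX P x)%:E = 1)%E.
Proof. by rewrite -esum_src; apply: eq_esum => x _; rewrite esum_row. Qed.

Lemma esum_margY : (\esum_(y in [set: B]) (margY P y)%:E = 1)%E.
Proof.
rewrite -esum_src esum_swap => [|x y]; last by rewrite lee_fin.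
by apply: eq_esum => y _; rewrite esum_col.
Qed.

Lemma le_margY (x : A) (y : B) : P n (x, y) <= margY P y.
Proof.
rewrite -lee_fin -esum_col.
by apply: (@esum_ge1 _ _ setT (fun x => (P n (x, y))%:E)); rewrite ?lee_fin.
Qed.

Lemma log2_ge0 (t : R) : 1 <= t -> 0 <= log2 t.
Proof. by move=> t1; rewrite divr_ge0 ?ln_ge0// ler1n. Qed.

Lemma info_ge0 (x : A) (y : B) : 0 <= log2 (condXY P x y)^-1.
Proof.
have [P0|P0] := eqVneq (P n (x, y)) 0.
  (* At zero mass the conventions [0^-1 = 0] and [ln 0 = 0] make the density 0. *)
  by rewrite /condXY P0 mul0r invr0 /log2 ln0 ?mul0r.
have {}P0 : 0 < P n (x, y) by rewrite lt_neqAle eq_sym P0 src_ge0.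
rewrite log2_ge0// /condXY invf_ge1 ?divr_gt0 ?margY_gt0//.
by rewrite ler_pdivrMr ?margY_gt0// mul1r le_margY.
Qed.

(** The weight is [w y] times the conditional law of x given y, so summing over x first leaves [w].
    It is used with [w] the y-marginal of the mixture, which yields a measure of total mass 1. *)
Lemma sumxy_margY (w : B -> R) : (forall y, 0 <= w y) ->
  (\esum_(x in [set: A]) \esum_(y in [set: B]) (P n (x, y) * w y / margY P y)%:E =
   \esum_(y in [set: B]) (w y)%:E)%E.
Proof.
move=> w0; have h x y : (0 <= (P n (x, y) * w y / margY P y)%:E)%E.
  by rewrite lee_fin divr_ge0 ?mulr_ge0// ltW// margY_gt0.
rewrite esum_swap//; apply: eq_esum => y _.
have d0 : 0 <= w y / margY P y by rewrite divr_ge0// ltW// margY_gt0.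
under eq_esum do rewrite -mulrA mulrC EFinM.
rewrite esumZl// => [|x]; last by rewrite lee_fin.
by rewrite esum_col -EFinM divfK// gt_eqF// margY_gt0.
Qed.

End source_facts.

(** * Marginals of a mixture *)

Section mixture_facts.
Context (R : realType) (X Y : countType).

Lemma mixtureC a1 a2 (P1 P2 : source R X Y) :
  mixture a1 a2 P1 P2 = mixture a2 a1 P2 P1.
Proof. by apply: functional_extensionality_dep => n; apply/funext => xy; rewrite /mixture addrC. Qed.

Context (a1 a2 : R) (P1 P2 : source R X Y).
Hypotheses (src1 : is_source P1) (src2 : is_source P2).
Hypotheses (a1_gt0 : 0 < a1) (a2_gt0 : 0 < a2) (a12 : a1 + a2 = 1).
Local Notation P := (mixture a1 a2 P1 P2 : source R X Y).

Let src1_ge0 n z : 0 <= P1 n z. Proof. by have [+ _] := src1 n; apply. Qed.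
Let src2_ge0 n z : 0 <= P2 n z. Proof. by have [+ _] := src2 n; apply. Qed.

Lemma mixture_ge0 n z : 0 <= P n z.
Proof. by rewrite addr_ge0// mulr_ge0// ltW. Qed.

Lemma esum_mixture n (T : choiceType) (S : set T) (f : T -> n.-tuple X * n.-tuple Y) :
  (\esum_(t in S) (P n (f t))%:E =
   a1%:E * (\esum_(t in S) (P1 n (f t))%:E) +
   a2%:E * \esum_(t in S) (P2 n (f t))%:E)%E.
Proof.
rewrite -!esumZl ?ltW//; try by move=> t; rewrite lee_fin.
by rewrite -esumD// => t _; rewrite -EFinM lee_fin mulr_ge0// ltW.
Qed.

Lemma margX_mixture n (x : n.-tuple X) :
  margX P x = a1 * margX P1 x + a2 * margX P2 x.
Proof. by rewrite /margX (esum_mixture _ _ _ (fun y => (x, y))) !esum_row. Qed.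

Lemma margY_mixture n (y : n.-tuple Y) :
  margY P y = a1 * margY P1 y + a2 * margY P2 y.
Proof. by rewrite /margY (esum_mixture _ _ _ (fun x => (x, y))) !esum_col. Qed.

Lemma is_source_mixture : is_source P.
Proof.
move=> n; split; first exact: mixture_ge0.
split.
  rewrite (esum_mixture _ _ _ id); have [_ [-> _]] := src1 n.
  by have [_ [-> _]] := src2 n; rewrite !mule1 -EFinD a12.
split => [x|y].
  by rewrite margX_mixture addr_gt0// mulr_gt0// margX_gt0.
by rewrite margY_mixture addr_gt0// mulr_gt0// margY_gt0.
Qed.

End mixture_facts.

(** * Conditional quantiles of the information density *)

Section hbar_facts.
Context (R : realType) (X Y : countType).

Definition tail (P : source R X Y) n (x : n.-tuple X) (a : R) :=
  [set y : n.-tuple Y | 0 < P n (x, y) /\ log2 (condXY P x y)^-1 > a].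

(** If adding [L] turns every admissible level for [P] into one for [Q], the infima differ
    accordingly. The premise is stated with joint masses, so that no conditional probability has to
    be handled later. *)
Lemma hbar_shift (P Q : source R X Y) n (x : n.-tuple X) (e e' L : R) :
  is_source P -> is_source Q ->
  (forall a, (\esum_(y in tail P n x a) (P n (x, y))%:E <= (e * margX P x)%:E)%E ->
    (\esum_(y in tail Q n x (a + L)) (Q n (x, y))%:E <= (e' * margX Q x)%:E)%E) ->
  (hbar Q e' x <= hbar P e x + L%:E)%E.
Proof.
have condYX_le (S : source R X Y) (d : R) (B : set (n.-tuple Y)) : is_source S ->
    (\esum_(y in B) (condYX S x y)%:E <= d%:E)%E =
    (\esum_(y in B) (S n (x, y))%:E <= (d * margX S x)%:E)%E.
  move=> srcS; have S0 := margX_gt0 _ _ _ _ _ srcS x.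
  have -> : (\esum_(y in B) (condYX S x y)%:E =
      (margX S x)^-1%:E * \esum_(y in B) (S n (x, y))%:E)%E.
    rewrite -esumZl ?invr_ge0 ?ltW//.
      by apply: eq_esum => y _; rewrite -EFinM mulrC.
    by move=> y; rewrite lee_fin; have [+ _] := srcS n; apply.
  by rewrite lee_pdivrMl// -EFinM mulrC.
move=> srcP srcQ PQ; rewrite -leeBlDr//.
apply: le_ereal_inf_tmp => _ [a /= + <-]; rewrite condYX_le// => /PQ Qa.
rewrite EFinN leeBlDr// -EFinD; apply: ereal_inf_lbound => /=.
by exists (a + L) => //=; rewrite condYX_le.
Qed.

Context (P : source R X Y) (n : nat).
Hypothesis srcP : is_source P.
Local Notation A := (n.-tuple X).
Local Notation B := (n.-tuple Y).

Let src_ge0 z : 0 <= P n z. Proof. by have [+ _] := srcP n; apply. Qed.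

Let condYX_esum x (S : set B) : (\esum_(y in S) (condYX P x y)%:E =
  (margX P x)^-1%:E * \esum_(y in S) (P n (x, y))%:E)%E.
Proof.
rewrite -esumZl ?invr_ge0 ?ltW ?margX_gt0// => [|y]; last by rewrite lee_fin.
by apply: eq_esum => y _; rewrite -EFinM mulrC.
Qed.

(** Since the density is nonnegative, the tail above a negative level contains every y of positive
    mass; its conditional probability is 1, which exceeds [e]. *)
Lemma hbar_ge0 (e : R) (x : A) : e < 1 -> (0 <= hbar P e x)%E.
Proof.
move=> e1; apply: le_ereal_inf_tmp => _ [a /= + <-]; rewrite condYX_esum => ha.
rewrite lee_fin leNgt; apply/negP => a0; move: ha; rewrite leNgt => /negP; apply.
suff -> : (\esum_(y in tail P n x a) (P n (x, y))%:E = (margX P x)%:E)%E.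
  by rewrite -EFinM mulVf ?lte_fin// gt_eqF// margX_gt0.
rewrite -esum_row// esum_mkcond; apply: eq_esum => y _.
case: ifPn => // /negP; rewrite inE /= => nt.
have [P0|P0] := ltP 0 (P n (x, y)).
  by exfalso; apply: nt; split => //; rewrite (lt_le_trans a0)// info_ge0.
by congr EFin; apply/eqP; rewrite eq_le src_ge0.
Qed.

Lemma hbar_nonincreasing (e e' : R) (x : A) : e <= e' ->
  (hbar P e' x <= hbar P e x)%E.
Proof.
move=> ee'; rewrite -[leRHS]adde0; apply: hbar_shift => // a; rewrite addr0.
move/le_trans; apply; rewrite lee_fin ler_wpM2r// ltW// margX_gt0//.
Qed.

(** Markov's inequality: the conditional mean of the density given x, divided by [e], is an
    admissible level. *)
Lemma hbar_markov (e : R) (x : A) : 0 < e ->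
  ((margX P x)%:E * hbar P e x <=
   e^-1%:E * \esum_(y in [set: B]) (P n (x, y) * log2 (condXY P x y)^-1)%:E)%E.
Proof.
move=> e0; set s := (\esum_(y in _) _)%E.
have PI0 y : (0 <= (P n (x, y) * log2 (condXY P x y)^-1)%:E)%E.
  by rewrite lee_fin mulr_ge0// info_ge0.
have s0 : (0 <= s)%E by exact: esum_ge0.
have m0 := margX_gt0 _ _ _ _ n srcP x.
case sE : s => [r| |]; last by move: s0; rewrite sE.
  rewrite lee_pdivlMl// muleA -EFinM; set c := e * margX P x.
  have c0 : 0 < c by rewrite mulr_gt0.
  suff : (hbar P e x <= (c^-1 * r)%:E)%E.
    move=> /(lee_wpmul2l (_ : 0 <= c%:E)%E); rewrite lee_fin => /(_ (ltW c0)).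
    by rewrite -EFinM mulVKf ?gt_eqF.
  apply: ereal_inf_lbound; exists (c^-1 * r) => //=.
  rewrite condYX_esum lee_pdivrMl// -EFinM [_ * e]mulrC -/c.
  have r0 : 0 <= r by rewrite -lee_fin -sE.
  (* At level 0 multiplying by the level gives no information; instead, a vanishing mean leaves no y
     with both positive mass and positive density. *)
  have [rE|rN0] := eqVneq r 0.
    rewrite rE mulr0 esum1 ?lee_fin ?ltW// => y [P0 I0].
    have /negP[] : ~~ ((P n (x, y) * log2 (condXY P x y)^-1)%:E <= s)%E.
      by rewrite sE rE lee_fin -ltNge mulr_gt0.
    by apply: (@esum_ge1 _ _ setT (fun y => (P n (x, y) * log2 (condXY P x y)^-1)%:E)).
  have {}r0 : 0 < r by rewrite lt_neqAle eq_sym rN0.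
  have a0 : 0 < c^-1 * r by rewrite mulr_gt0 ?invr_gt0.
    rewrite -(@lee_pmul2l _ (c^-1 * r)%:E) ?lte_fin// -[leRHS]EFinM.
  rewrite [_ * c]mulrC mulVKf ?gt_eqF// -sE -(esumZl _ _ _ _ _ (ltW a0)) => [|y]; last by rewrite lee_fin.
  apply: le_trans (subset_esum _ _ _ _ _ (@subsetT _ (tail P n x (c^-1 * r)))).
  apply: le_esum => y [P0 Ia].
  by rewrite -EFinM lee_fin [leRHS]mulrC ler_wpM2r// ltW.
by rewrite gt0_muley ?leey// lte_fin invr_gt0.
Qed.

End hbar_facts.

Arguments tail {R X Y} P n x a.

(** * The base-2 logarithm *)

Section log2_facts.
Context (R : realType).

Let ln2_gt0 : 0 < ln 2 :> R. Proof. by rewrite ln_gt0// ltr1n. Qed.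

Lemma log2M : {in Num.pos &, {morph @log2 R : x y / x * y >-> x + y}}.
Proof. by move=> x y x0 y0; rewrite /log2 lnM// mulrDl. Qed.

Lemma ltr_log2 : {in Num.pos &, {mono @log2 R : x y / x < y}}.
Proof. by move=> x y x0 y0; rewrite /log2 ltr_pM2r ?invr_gt0// ltr_ln. Qed.

Lemma ler_log2 : {in Num.pos &, {mono @log2 R : x y / x <= y}}.
Proof. by move=> x y x0 y0; rewrite /log2 ler_pM2r ?invr_gt0// ler_ln. Qed.

Lemma log2_sublinear (x : R) : 0 < x -> log2 x <= x / ln 2.
Proof. by move=> x0; rewrite ler_pM2r ?invr_gt0// ltW// ln_sublinear. Qed.

End log2_facts.

(** * Comparison of a mixture with one of its components *)

Section mixture_component.
Context (R : realType) (X Y : countType) (a1 a2 : R) (P1 P2 : source R X Y).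
Hypotheses (src1 : is_source P1) (src2 : is_source P2).
Hypotheses (a1_gt0 : 0 < a1) (a2_gt0 : 0 < a2) (a12 : a1 + a2 = 1).
Context (n : nat).
Local Notation P := (mixture a1 a2 P1 P2 : source R X Y).
Local Notation info P x y := (log2 (condXY P x y)^-1).
Local Notation A := (n.-tuple X).
Local Notation B := (n.-tuple Y).

Let src : is_source P. Proof. exact: is_source_mixture. Qed.
Let src1_ge0 z : 0 <= P1 n z. Proof. by have [+ _] := src1 n; apply. Qed.
Let src2_ge0 z : 0 <= P2 n z. Proof. by have [+ _] := src2 n; apply. Qed.
Let src_ge0 z : 0 <= P n z. Proof. by have [+ _] := src n; apply. Qed.
Let mX1_gt0 (x : A) : 0 < margX P1 x. Proof. exact: margX_gt0. Qed.
Let mX2_gt0 (x : A) : 0 < margX P2 x. Proof. exact: margX_gt0. Qed.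
Let mY1_gt0 (y : B) : 0 < margY P1 y. Proof. exact: margY_gt0. Qed.
Let mY_gt0 (y : B) : 0 < margY P y. Proof. exact: margY_gt0. Qed.

Let le_component (z : A * B) : a1 * P1 n z <= P n z.
Proof. by rewrite /mixture lerDl mulr_ge0// ltW. Qed.

Let mixture_gt0 (z : A * B) : 0 < P1 n z -> 0 < P n z.
Proof. by move=> P0; rewrite (lt_le_trans _ (le_component z))// mulr_gt0. Qed.

(** As [P >= a1 * P1], the difference J - J1 is at most [log2 t] with
    [t = margY P y / (a1 * margY P1 y)], and [log2 t <= t / ln 2]. The gain is that [P1 * t] has
    total mass [a1^-1]. *)
Lemma info_mixture_le (x : A) (y : B) :
  P1 n (x, y) * info P x y <= P1 n (x, y) * info P1 x y +
    (a1 * ln 2)^-1 * (P1 n (x, y) * margY P y / margY P1 y).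
Proof.
have [P0|P0] := eqVneq (P1 n (x, y)) 0; first by rewrite P0 !mul0r mulr0 addr0.
have {}P0 : 0 < P1 n (x, y) by rewrite lt_neqAle eq_sym P0 src1_ge0.
set t := margY P y / (a1 * margY P1 y).
have t0 : 0 < t by rewrite divr_gt0// mulr_gt0.
have -> : (a1 * ln 2)^-1 * (P1 n (x, y) * margY P y / margY P1 y) =
    P1 n (x, y) * (t / ln 2).
  by rewrite /t !invfM; ring.
rewrite -mulrDr ler_wpM2l// (le_trans _ (lerD (lexx _) (log2_sublinear _ _ t0)))//.
have P1c : 0 < condXY P1 x y by rewrite divr_gt0.
have Pc : 0 < condXY P x y by rewrite divr_gt0// mixture_gt0.
rewrite -log2M ?posrE ?invr_gt0// ler_log2 ?posrE ?mulr_gt0 ?invr_gt0//; last first.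
  exact: mulr_gt0.
have -> : (condXY P1 x y)^-1 * t = (a1 * P1 n (x, y) / margY P y)^-1.
  by rewrite /t /condXY; field; rewrite !gt_eqF.
rewrite lef_pV2 ?posrE ?divr_gt0 ?mulr_gt0 ?mixture_gt0//.
by rewrite ler_pM2r ?invr_gt0// le_component.
Qed.

Definition deviant (L : R) (x : A) :=
  [set y : B | 0 < P1 n (x, y) /\ L < `|info P x y - info P1 x y|].

(** A change of measure in each direction: [J - J1 > log2 M] forces [a1 * M * P1 <= w], by
    [a1 * P1 <= P], and [J1 - J > log2 M] forces [a1 * M * P1 <= P], by the same bound for the
    y-marginals. Both dominating measures have mass 1, whence the factor 2. *)
Lemma esum_deviant (M : R) : 0 < M ->
  (\esum_(x in [set: A]) \esum_(y in deviant (log2 M) x) (P1 n (x, y))%:E <=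
    (2 / (a1 * M))%:E)%E.
Proof.
move=> M0; have aM0 : 0 < (a1 * M)^-1 by rewrite invr_gt0 mulr_gt0.
(* [w] has total mass 1 and dominates [a1 * M * P1] where [J - J1 > log2 M]. *)
pose w x y := P1 n (x, y) * margY P y / margY P1 y.
have w0 x y : 0 <= w x y by rewrite divr_ge0 ?mulr_ge0// ltW.
have le_w x y : deviant (log2 M) x y ->
    P1 n (x, y) <= (a1 * M)^-1 * (P n (x, y) + w x y).
  move=> [P0]; have P1c : 0 < condXY P1 x y by rewrite divr_gt0.
  have Pc : 0 < condXY P x y by rewrite divr_gt0// mixture_gt0.
  have lt_info (Q Q' : source R X Y) : 0 < condXY Q x y -> 0 < condXY Q' x y ->
      log2 M < info Q x y - info Q' x y -> M * condXY Q x y < condXY Q' x y.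
    move=> Q0 Q'0; rewrite ltrBrDr -log2M ?posrE ?invr_gt0//.
    rewrite ltr_log2 ?posrE ?mulr_gt0 ?invr_gt0//.
    by rewrite ltr_pdivrMr// mulrC ltr_pdivlMr.
    rewrite mulrC ler_pdivlMr ?mulr_gt0// lter_normr opprB => /orP[] /lt_info.
    move=> /(_ Pc P1c); rewrite /condXY mulrA ltr_pdivrMr// mulrAC.
    rewrite ltr_pdivlMr// => h; apply: (@le_trans _ _ (w x y)); last by rewrite lerDr.
    rewrite ler_pdivlMr// (le_trans _ (ltW h))//.
    rewrite [leLHS](_ : _ = M * (a1 * P1 n (x, y)) * margY P1 y); last by ring.
    by rewrite ler_pM2r// ler_pM2l// le_component.
  move=> /(_ P1c Pc); rewrite /condXY mulrA ltr_pdivrMr// mulrAC.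
  rewrite ltr_pdivlMr// => h; apply: (@le_trans _ _ (P n (x, y))); last by rewrite lerDl.
  rewrite -(ler_pM2r (mY_gt0 y)).
  rewrite [leLHS](_ : _ = a1 * (M * P1 n (x, y) * margY P y)); last by ring.
  apply: (@le_trans _ _ (a1 * (P n (x, y) * margY P1 y))).
    by rewrite ler_pM2l// ltW.
  rewrite mulrCA ler_wpM2l// margY_mixture// lerDl mulr_ge0 ?ltW// margY_gt0//.
have w0E x y : (0 <= (w x y)%:E)%E by rewrite lee_fin.
have P0E x y : (0 <= (P n (x, y))%:E)%E by rewrite lee_fin.
apply: (@le_trans _ _ (\esum_(x in [set: A]) ((a1 * M)^-1%:E *
    ((margX P x)%:E + \esum_(y in [set: B]) (w x y)%:E)))%E).
  apply: le_esum => x _.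
  rewrite -esum_row// -esumD// -(esumZl _ _ _ _ _ (ltW aM0)) => [|y]; last first.
    exact: adde_ge0.
  apply: le_trans (subset_esum _ _ _ _ _ (@subsetT _ (deviant (log2 M) x))).
  by apply: le_esum => y /le_w; rewrite -EFinD -EFinM lee_fin.
have mX0 x : (0 <= (margX P x)%:E)%E by rewrite lee_fin ltW// margX_gt0.
have sw0 x : (0 <= \esum_(y in [set: B]) (w x y)%:E)%E by exact: esum_ge0.
rewrite (esumZl _ _ _ _ _ (ltW aM0)) => [|x]; last exact: adde_ge0.
rewrite esumD// esum_margX// sumxy_margY// => [|y]; last exact: ltW.
by rewrite esum_margY// -EFinD -EFinM mulrC.
Qed.

(** On this set [margX P] lies between [a1 * margX P1] and [1 + eta] times it, so that given x the
    mixture almost always selects the first component. *)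
Definition dominated (eta : R) := [set x : A |
  a2 * margX P2 x <= eta * (a1 * margX P1 x)].

(** The second condition bounds the conditional probability of a deviant y given x, cleared of its
    denominator. *)
Definition typical (eta L : R) := dominated eta `&` [set x : A |
  (\esum_(y in deviant L x) (P1 n (x, y))%:E <= (eta * margX P1 x)%:E)%E].

(* Points of zero [P1]-mass are exempted: the tail sets of the two sources
   are only comparable on the support of [P1]. *)
Let esum1_le (S D T : set B) (x : A) :
  (forall y, S y -> 0 < P1 n (x, y) -> D y \/ T y) ->
  (\esum_(y in S) (P1 n (x, y))%:E <=
   \esum_(y in D) (P1 n (x, y))%:E + \esum_(y in T) (P1 n (x, y))%:E)%E.
Proof.
move=> SDT; have P0 y : (0 <= (P1 n (x, y))%:E)%E by rewrite lee_fin.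
apply: le_trans (esumU_le _ _ _ _ _ P0).
apply: (@le_trans _ _ (\esum_(y in S `&` [set y | (0 < P1 n (x, y))%R]) (P1 n (x, y))%:E)%E).
  rewrite esum_mkcondr; apply: le_esum => y _; case: ifPn => //.
  by rewrite notin_setE/= => /negP; rewrite -leNgt lee_fin.
by apply: subset_esum => y [Sy Py]; exact: SDT.
Qed.

(** The two losses [eta] have different sources. Under [P1], a y in the tail of J above [a + L] is
    deviant or in the tail of J1 above [a]; under [P2], the whole row is counted, and domination
    makes it small. *)
Lemma hbar_mixture_le (eta L e : R) (x : A) : 0 <= eta -> 0 <= e ->
  typical eta L x -> (hbar P (e + 2 * eta) x <= hbar P1 e x + L%:E)%E.
Proof.
move=> eta0 e0 [/= dom dev]; apply: hbar_shift => // a Ha.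
rewrite (esum_mixture _ _ _ _ _ _ _ src1 src2 a1_gt0 a2_gt0 n _ _ (fun y => (x, y))).
have le2 : (\esum_(y in tail P n x (a + L)) (P2 n (x, y))%:E <= (margX P2 x)%:E)%E.
  by rewrite -esum_row//; apply: subset_esum.
have le1 : (\esum_(y in tail P n x (a + L)) (P1 n (x, y))%:E <=
    ((eta + e) * margX P1 x)%:E)%E.
  rewrite mulrDl EFinD; apply: le_trans (leeD dev Ha).
  apply: esum1_le => y [_ Iy] P0.
  have [h|h] := ltP L `|info P x y - info P1 x y|; [by left|right; split => //].
  by move: h; rewrite ler_norml => /andP[_]; move: Iy; lra.
apply: (@le_trans _ _ (a1%:E * ((eta + e) * margX P1 x)%:E + a2%:E * (margX P2 x)%:E)%E).
  by rewrite leeD// lee_wpmul2l// lee_fin ltW.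
rewrite -!EFinM -EFinD lee_fin margX_mixture//.
apply: (@le_trans _ _ ((e + 2 * eta) * (a1 * margX P1 x))).
  by move: dom; rewrite /dominated/=; lra.
by rewrite ler_wpM2l ?addr_ge0 ?mulr_ge0// lerDl mulr_ge0 ?ltW.
Qed.

(** Deviant y cost [eta]. For the others, [a1 * P1 <= P] and domination bound the conditional tail
    mass by [e * (1 + eta)], which is at most [e + eta] because [e <= 1]. *)
Lemma hbar_component_le (eta L e : R) (x : A) : 0 <= eta -> 0 <= e <= 1 ->
  typical eta L x -> (hbar P1 (e + 2 * eta) x <= hbar P e x + L%:E)%E.
Proof.
move=> eta0 /andP[e0 e1] [/= dom dev]; apply: hbar_shift => // a Ha.
apply: (@le_trans _ _ ((eta * margX P1 x)%:E +
    \esum_(y in tail P n x a) (P1 n (x, y))%:E)%E).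
  apply: (le_trans _ (leeD dev (lexx _))).
  apply: esum1_le => y [_ Iy] P0.
  have [h|h] := ltP L `|info P x y - info P1 x y|; [by left|right; split => //].
    exact: mixture_gt0.
  by move: h; rewrite ler_norml => /andP[+ _]; move: Iy; lra.
apply: (@le_trans _ _ ((eta * margX P1 x)%:E + (e * (1 + eta) * margX P1 x)%:E)%E).
  rewrite leeD2l// -(@lee_pmul2l _ a1%:E) ?lte_fin// -[leRHS]EFinM.
  apply: (@le_trans _ _ (e * margX P x)%:E).
    apply: le_trans Ha; rewrite -(esumZl _ _ _ _ _ (ltW a1_gt0)) => [|y].
      by apply: le_esum => y _; rewrite -EFinM lee_fin le_component.
    by rewrite lee_fin.
  rewrite lee_fin margX_mixture// [leRHS](_ : _ = e * (a1 * margX P1 x + eta * (a1 * margX P1 x))).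
    by rewrite ler_wpM2l// lerD2l.
  by ring.
rewrite -EFinD lee_fin -mulrDl ler_pM2r// mulrDr mulr1 addrCA lerD2l.
by rewrite mulr_natl mulr2n lerD2l ler_piMl.
Qed.

(** Union bound, with Markov's inequality in x applied to the deviant mass. *)
Lemma atypical_le (eta M : R) : 0 < eta -> 0 < M ->
  (\esum_(x in ~` typical eta (log2 M)) (margX P1 x)%:E <=
   \esum_(x in ~` dominated eta) (margX P1 x)%:E + (2 / (a1 * M * eta))%:E)%E.
Proof.
move=> eta0 M0; have m0 (x : A) : (0 <= (margX P1 x)%:E)%E by rewrite lee_fin ltW.
pose dev (x : A) := (\esum_(y in deviant (log2 M) x) (P1 n (x, y))%:E)%E.
have dev0 x : (0 <= dev x)%E by apply: esum_ge0 => y _; rewrite lee_fin.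
rewrite setCI; apply: (le_trans (esumU_le _ _ _ _ _ m0)); rewrite leeD2l//.
apply: (@le_trans _ _ (eta^-1%:E * \esum_(x in [set: A]) dev x)%E); last first.
  rewrite lee_pdivrMl// (le_trans (esum_deviant _ M0))// -EFinM lee_fin.
  by rewrite [leRHS](_ : _ = 2 / (a1 * M))//; field; rewrite !gt_eqF.
have i0 : 0 <= eta^-1 by rewrite invr_ge0 ltW.
rewrite -(esumZl _ _ _ _ _ i0 dev0).
apply: le_trans (subset_esum _ _ _ _ _ (@subsetT _ _)).
apply: le_esum => x /= /negP; rewrite -ltNge => /ltW.
by rewrite lee_pdivlMl.
Qed.

End mixture_component.

Arguments typical {R X Y} a1 a2 P1 P2 {n} eta L.
Arguments dominated {R X Y} a1 a2 P1 P2 {n} eta.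

(** The contribution of x to the conditional entropy of the source at length [n]: summed over all x
    it gives that entropy in bits, possibly infinite. *)
Definition row_info {R : realType} {X Y : countType} (P : source R X Y) {n}
    (x : n.-tuple X) : \bar R :=
  \esum_(y in [set: n.-tuple Y]) (P n (x, y) * log2 (condXY P x y)^-1)%:E.

(** * Averaged quantiles of a single source *)

Section Hs_eps_facts.
Context (R : realType) (X Y : countType) (P : source R X Y) (n : nat).
Hypothesis srcP : is_source P.
Local Open Scope ereal_scope.

Lemma row_info_ge0 (x : n.-tuple X) : 0 <= row_info P x.
Proof.
apply: esum_ge0 => y _; rewrite lee_fin mulr_ge0 ?info_ge0//.
by have [+ _] := srcP n; apply.
Qed.

Lemma margX_hbar_ge0 (e : R) (x : n.-tuple X) : (e < 1)%R ->
  0 <= (margX P x)%:E * hbar P e x.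
Proof. by move=> e1; rewrite mule_ge0 ?hbar_ge0// lee_fin ltW// margX_gt0. Qed.

(** For [e < 1] the quantiles are nonnegative, so the negative part in [esum_signed] vanishes. *)
Lemma Hs_epsE (e : R) : (e < 1)%R ->
  Hs_eps P e n = \esum_(x in [set: n.-tuple X]) (margX P x)%:E * hbar P e x.
Proof.
move=> e1; have h x := margX_hbar_ge0 e x e1.
rewrite /Hs_eps /esum_signed [X in _ - X]esum1 ?sube0 => [|x _].
  by apply: eq_esum => x _; rewrite funeposE max_l.
by rewrite funenegE max_r// leeNl oppe0.
Qed.

Lemma Hs_eps_ge0 (e : R) : (e < 1)%R -> 0 <= Hs_eps P e n.
Proof. by move=> e1; rewrite Hs_epsE// esum_ge0// => x _; exact: margX_hbar_ge0. Qed.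

Lemma Hs_eps_nonincreasing (e e' : R) : (e <= e')%R -> (e' < 1)%R ->
  Hs_eps P e' n <= Hs_eps P e n.
Proof.
move=> ee' e'1; rewrite !Hs_epsE ?(le_lt_trans ee')//; apply: le_esum => x _.
by rewrite lee_wpmul2l ?hbar_nonincreasing// lee_fin ltW// margX_gt0.
Qed.

Lemma Hs_eps_markov (e : R) : (0 < e)%R -> (e < 1)%R ->
  Hs_eps P e n <= e^-1%:E * \esum_(x in [set: n.-tuple X]) row_info P x.
Proof.
move=> e0 e1; rewrite Hs_epsE// -esumZl ?invr_ge0 ?(ltW e0)//; last first.
  by move=> x; exact: row_info_ge0.
by apply: le_esum => x _; exact: hbar_markov.
Qed.

Lemma Hs_eps_shift (e L : R) : (e < 1)%R -> (0 <= L)%R ->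
  \esum_(x in [set: n.-tuple X]) (margX P x)%:E * (hbar P e x + L%:E) =
  Hs_eps P e n + L%:E.
Proof.
move=> e1 L0; have m0 (x : n.-tuple X) : 0 <= (margX P x)%:E.
  by rewrite lee_fin ltW// margX_gt0.
rewrite Hs_epsE// -[X in _ + X]mule1 -(esum_margX _ _ _ P n)//.
rewrite -(esumZl _ _ _ _ _ L0 m0) -esumD => [|x _|x _].
- by apply: eq_esum => x _; rewrite ge0_muleDr ?hbar_ge0// [X in _ + X]muleC.
- exact: margX_hbar_ge0.
- exact: mule_ge0.
Qed.

End Hs_eps_facts.

(** * Bounds through one component at fixed length *)

Section component_bounds.
Context (R : realType) (X Y : countType) (a1 a2 : R) (P1 P2 : source R X Y).
Hypotheses (src1 : is_source P1) (src2 : is_source P2).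
Hypotheses (a1_gt0 : 0 < a1) (a2_gt0 : 0 < a2) (a12 : a1 + a2 = 1).
Context (n : nat) (eta L e : R).
Hypotheses (eta_ge0 : 0 <= eta) (L_ge0 : 0 <= L).
Hypotheses (e_gt0 : 0 < e) (eeta_lt1 : e + 2 * eta < 1).
Local Notation P := (mixture a1 a2 P1 P2 : source R X Y).
Local Notation info P x y := (log2 (condXY P x y)^-1).
Local Notation A := (n.-tuple X).
Local Notation B := (n.-tuple Y).
Local Notation typ := (@typical R X Y a1 a2 P1 P2 n eta L).

Let src : is_source P. Proof. exact: is_source_mixture. Qed.
Let e_lt1 : e < 1. Proof. by move: eta_ge0 eeta_lt1; lra. Qed.
Let src1_ge0 z : 0 <= P1 n z. Proof. by have [+ _] := src1 n; apply. Qed.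
Let mX1_gt0 (x : A) : 0 < margX P1 x. Proof. exact: margX_gt0. Qed.
Let mX_gt0 (x : A) : 0 < margX P x. Proof. exact: margX_gt0. Qed.

Lemma esum_typical_le :
  (\esum_(x in typ) ((margX P x)%:E * hbar P (e + 2 * eta) x) <=
   ((1 + eta) * a1)%:E * (Hs_eps P1 e n + L%:E))%E.
Proof.
have c0 : 0 <= (1 + eta) * a1 by rewrite mulr_ge0 ?addr_ge0// ltW.
have h0 (x : A) : (0 <= hbar P1 e x + L%:E)%E by rewrite adde_ge0 ?hbar_ge0.
rewrite -Hs_eps_shift// -(esumZl _ _ _ _ _ c0) => [|x]; last first.
  by rewrite mule_ge0// lee_fin ltW.
apply: le_trans (subset_esum _ _ _ _ _ (@subsetT _ typ)).
apply: le_esum => x typx; rewrite muleA -EFinM lee_pmul ?hbar_ge0//.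
- by rewrite lee_fin ltW.
- rewrite lee_fin margX_mixture//; case: typx; rewrite /dominated/= => + _.
  by lra.
- by apply: hbar_mixture_le => //; exact: ltW.
Qed.

(** Summing [info_mixture_le]: replacing J1 by J costs at most a constant independent of [n] and
    [S], which disappears after division by [n]. *)
Lemma esum_info_mixture_le (S : set A) :
  (\esum_(x in S) (a1%:E * \esum_(y in [set: B]) (P1 n (x, y) * info P x y)%:E) <=
   a1%:E * (\esum_(x in S) row_info P1 x) + (ln 2)^-1%:E)%E.
Proof.
have l2 : 0 < (ln 2 : R)^-1 by rewrite invr_gt0 ln_gt0// ltr1n.
pose w x y := P1 n (x, y) * margY P y / margY P1 y.
have mY0 (y : B) : 0 <= margY P y by rewrite ltW// margY_gt0.
have w0 (x : A) (y : B) : (0 <= (w x y)%:E)%E.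
  by rewrite lee_fin divr_ge0 ?mulr_ge0// ltW// margY_gt0.
have sw0 (x : A) : (0 <= \esum_(y in [set: B]) (w x y)%:E)%E by exact: esum_ge0.
have r0 (x : A) : (0 <= row_info P1 x)%E by exact: row_info_ge0.
apply: (@le_trans _ _ (\esum_(x in S) (a1%:E * row_info P1 x +
    (ln 2)^-1%:E * \esum_(y in [set: B]) (w x y)%:E))%E).
  apply: le_esum => x _; rewrite /row_info.
  have i0 y : (0 <= (P1 n (x, y) * info P1 x y)%:E)%E.
    by rewrite lee_fin mulr_ge0// info_ge0.
  have j0 y : (0 <= (P1 n (x, y) * info P x y)%:E)%E.
    by rewrite lee_fin mulr_ge0// info_ge0.
  rewrite -(esumZl _ _ _ _ _ (ltW a1_gt0) i0) -(esumZl _ _ _ _ _ (ltW a1_gt0) j0).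
  rewrite -(esumZl _ _ _ _ _ (ltW l2) (w0 x)) -esumD => [|y _|y _]; last 2 first.
  - by rewrite mule_ge0// lee_fin ltW.
  - by rewrite mule_ge0// lee_fin ltW.
  apply: le_esum => y _; rewrite -!EFinM -EFinD lee_fin.
  have := info_mixture_le _ _ _ _ _ _ _ src1 src2 a1_gt0 a2_gt0 a12 n x y.
  move=> /(ler_wpM2l (ltW a1_gt0)); rewrite mulrDr => /le_trans; apply; rewrite lerD2l.
  rewrite -/(w x y) [leLHS](_ : _ = (ln 2)^-1 * w x y)//.
  by field; rewrite !gt_eqF// -invr_gt0.
rewrite esumD => [|x _|x _]; [|by rewrite mule_ge0// lee_fin ltW..].
rewrite (esumZl _ _ _ _ _ (ltW a1_gt0) r0) (esumZl _ _ _ _ _ (ltW l2) sw0) leeD2l//.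
rewrite -[leRHS]mule1 lee_wpmul2l ?lee_fin ?(ltW l2)//.
rewrite -(esum_margY _ _ _ P n)// -(sumxy_margY _ _ _ P1 n)//.
exact: subset_esum.
Qed.

(** The pointwise comparison is used on typical x and Markov's inequality for [P1] elsewhere. The
    weight [a1 * margX P1 x] is kept so that the bounds of both components add up to an average
    under [margX P]. *)
Lemma Hs_eps_component_le :
  (a1%:E * Hs_eps P1 (e + 2 * eta) n <=
   \esum_(x in [set: A]) (a1 * margX P1 x)%:E * (hbar P e x + L%:E) +
   e^-1%:E * (a1%:E * \esum_(x in ~` typ) row_info P1 x))%E.
Proof.
have r0 (x : A) : (0 <= row_info P1 x)%E by exact: row_info_ge0.
have mh0 (x : A) := margX_hbar_ge0 _ _ _ _ _ src1 _ x eeta_lt1.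
have h0 (x : A) : (0 <= hbar P e x + L%:E)%E by rewrite adde_ge0 ?hbar_ge0.
have i0 : 0 <= e^-1 by rewrite invr_ge0 ltW.
have am0 (x : A) : 0 <= a1 * margX P1 x by rewrite mulr_ge0// ltW.
rewrite Hs_epsE// -[in leRHS](esumZl _ _ _ _ _ (ltW a1_gt0) r0).
have ar0 (x : A) : (0 <= a1%:E * row_info P1 x)%E by rewrite mule_ge0// lee_fin ltW.
rewrite -(esumZl _ _ _ _ _ i0 ar0) -(esumZl _ _ _ _ _ (ltW a1_gt0) mh0).
rewrite -[X in \esum_(x in X) (a1%:E * (_ * _))%E](setUv typ).
apply: (le_trans (esumU_le _ _ _ _ _ _)).
  by move=> x; rewrite mule_ge0// lee_fin ltW.
rewrite leeD//.
  apply: le_trans (subset_esum _ _ _ _ _ (@subsetT _ typ)).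
  apply: le_esum => x typx; rewrite muleA -EFinM lee_wpmul2l ?lee_fin//.
  by apply: hbar_component_le => //; rewrite !ltW.
apply: le_esum => x _; rewrite [leRHS]muleCA lee_wpmul2l ?lee_fin ?(ltW a1_gt0)//.
apply: le_trans (hbar_markov _ _ _ _ _ src1 _ x e_gt0).
rewrite lee_wpmul2l ?lee_fin ?(ltW (mX1_gt0 x))//.
by apply: hbar_nonincreasing => //; rewrite lerDl mulr_ge0.
Qed.

End component_bounds.

(** * Comparison of the mixture with both components at fixed length *)

Section mixture_bounds.
Context (R : realType) (X Y : countType) (a1 a2 : R) (P1 P2 : source R X Y).
Hypotheses (src1 : is_source P1) (src2 : is_source P2).
Hypotheses (a1_gt0 : 0 < a1) (a2_gt0 : 0 < a2) (a12 : a1 + a2 = 1).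
Context (n : nat) (eta L e : R).
Hypotheses (eta_ge0 : 0 <= eta) (L_ge0 : 0 <= L).
Hypotheses (e_gt0 : 0 < e) (eeta_lt1 : e + 2 * eta < 1).
Local Notation P := (mixture a1 a2 P1 P2 : source R X Y).
Local Notation A := (n.-tuple X).
Local Notation B := (n.-tuple Y).
Local Notation atyp1 := (~` @typical R X Y a1 a2 P1 P2 n eta L).
Local Notation atyp2 := (~` @typical R X Y a2 a1 P2 P1 n eta L).

Let src : is_source P. Proof. exact: is_source_mixture. Qed.
Let a21 : a2 + a1 = 1. Proof. by rewrite addrC. Qed.
Let e_lt1 : e < 1. Proof. by move: eta_ge0 eeta_lt1; lra. Qed.
Let mX1_gt0 (x : A) : 0 < margX P1 x. Proof. exact: margX_gt0. Qed.
Let mX2_gt0 (x : A) : 0 < margX P2 x. Proof. exact: margX_gt0. Qed.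

(** Each x is typical for the first component, for the second, or for neither. In the last case
    Markov's inequality is applied to the mixture, and passing from J to J1 and J2 costs [(ln 2)^-1]
    for each component. *)
Lemma Hs_eps_mixture_le :
  (Hs_eps P (e + 2 * eta) n <=
   (1 + eta)%:E * (a1%:E * Hs_eps P1 e n + a2%:E * Hs_eps P2 e n + L%:E) +
   e^-1%:E * (a1%:E * (\esum_(x in atyp1) row_info P1 x) +
              a2%:E * (\esum_(x in atyp2) row_info P2 x) + (2 / ln 2)%:E))%E.
Proof.
pose S := atyp1 `&` atyp2.
have mh0 (x : A) := margX_hbar_ge0 _ _ _ _ _ src _ x eeta_lt1.
have eta1 : 0 <= 1 + eta by rewrite addr_ge0.
have H1 := Hs_eps_ge0 _ _ _ _ n src1 _ e_lt1.
have H2 := Hs_eps_ge0 _ _ _ _ n src2 _ e_lt1.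
have r1 (x : A) : (0 <= row_info P1 x)%E by exact: row_info_ge0.
have r2 (x : A) : (0 <= row_info P2 x)%E by exact: row_info_ge0.
rewrite Hs_epsE//.
have cover : [set: A] `<=`
    @typical R X Y a1 a2 P1 P2 n eta L `|` (@typical R X Y a2 a1 P2 P1 n eta L `|` S).
  move=> x _; have [t1|t1] := pselect (@typical R X Y a1 a2 P1 P2 n eta L x); first by left.
  have [t2|t2] := pselect (@typical R X Y a2 a1 P2 P1 n eta L x); first by right; left.
  by right; right.
apply: (le_trans (subset_esum _ _ _ _ _ cover)).
apply: (le_trans (esumU_le _ _ _ _ _ mh0)).
apply: (le_trans (leeD (lexx _) (esumU_le _ _ _ _ _ mh0))).
rewrite addeA; apply: leeD.
  apply: (@le_trans _ _ (((1 + eta) * a1)%:E * (Hs_eps P1 e n + L%:E) +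
                         ((1 + eta) * a2)%:E * (Hs_eps P2 e n + L%:E))%E).
    apply: leeD; first exact: esum_typical_le.
    by rewrite mixtureC; exact: esum_typical_le.
  move: (Hs_eps P1 e n) (Hs_eps P2 e n) H1 H2 => h1 h2 h1_ge0 h2_ge0.
  have aE : L%:E = (a1%:E * L%:E + a2%:E * L%:E)%E.
    by rewrite -!EFinM -EFinD -mulrDl a12 mul1r.
  rewrite !EFinM -!muleA -ge0_muleDr.
  - apply: lee_wpmul2l; first by rewrite lee_fin.
    by rewrite [X in (_ <= _ + X)%E]aE !ge0_muleDr// addeACA.
  - by rewrite mule_ge0 ?adde_ge0// lee_fin ltW.
  - by rewrite mule_ge0 ?adde_ge0// lee_fin ltW.
(* The Markov bound for the mixture is linear in the averaging measure: it splits into averages of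
   the same density J under [P1] and under [P2]. *)
pose c (Q : source R X Y) (x : A) : \bar R :=
  (\esum_(y in [set: B]) (Q n (x, y) * log2 (condXY P x y)^-1)%:E)%E.
have c0 (Q : source R X Y) x : is_source Q -> (0 <= c Q x)%E.
  move=> srcQ; apply: esum_ge0 => y _; rewrite lee_fin mulr_ge0 ?info_ge0//.
  by have [+ _] := srcQ n; apply.
have i0 : 0 <= e^-1 by rewrite invr_ge0 ltW.
apply: (@le_trans _ _ (e^-1%:E * \esum_(x in S) (a1%:E * c P1 x + a2%:E * c P2 x))%E).
  rewrite -esumZl// => [|x]; last by rewrite adde_ge0// mule_ge0 ?c0// lee_fin ltW.
  apply: le_esum => x _; apply: (@le_trans _ _ ((margX P x)%:E * hbar P e x)%E).
    rewrite lee_wpmul2l ?lee_fin ?(ltW (margX_gt0 _ _ _ _ _ src _))//.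
    by apply: hbar_nonincreasing => //; rewrite lerDl mulr_ge0.
  apply: (le_trans (hbar_markov _ _ _ _ _ src _ x e_gt0)).
  rewrite lee_wpmul2l ?lee_fin// /c -!esumZl ?(ltW a1_gt0) ?(ltW a2_gt0)//.
  - rewrite -esumD => [|y _|y _].
    + by apply: le_esum => y _; rewrite -!EFinM -EFinD lee_fin /mixture; lra.
    + rewrite mule_ge0 ?lee_fin ?(ltW a1_gt0)// mulr_ge0 ?info_ge0//.
      by have [+ _] := src1 n; apply.
    + rewrite mule_ge0 ?lee_fin ?(ltW a2_gt0)// mulr_ge0 ?info_ge0//.
      by have [+ _] := src2 n; apply.
  - by move=> y; rewrite lee_fin mulr_ge0 ?info_ge0//; have [+ _] := src2 n; apply.
  - by move=> y; rewrite lee_fin mulr_ge0 ?info_ge0//; have [+ _] := src1 n; apply.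
rewrite lee_wpmul2l ?lee_fin// esumD => [|x _|x _]; last 2 first.
- by rewrite mule_ge0 ?c0// lee_fin ltW.
- by rewrite mule_ge0 ?c0// lee_fin ltW.
rewrite (_ : 2 / ln 2 = (ln 2)^-1 + (ln 2)^-1); last by rewrite mulr_natl mulr2n.
rewrite EFinD addeACA; apply: leeD.
  apply: (le_trans (esum_info_mixture_le _ _ _ _ _ _ _ src1 src2 a1_gt0 a2_gt0 a12 _ _)).
  rewrite leeD2r// lee_wpmul2l ?lee_fin ?(ltW a1_gt0)//.
  by apply: subset_esum => x [].
rewrite /c mixtureC.
apply: (le_trans (esum_info_mixture_le _ _ _ _ _ _ _ src2 src1 a2_gt0 a1_gt0 a21 _ _)).
rewrite leeD2r// lee_wpmul2l ?lee_fin ?(ltW a2_gt0)//.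
by apply: subset_esum => x [].
Qed.

Lemma Hs_eps_components_le :
  (a1%:E * Hs_eps P1 (e + 2 * eta) n + a2%:E * Hs_eps P2 (e + 2 * eta) n <=
   Hs_eps P e n + L%:E +
   e^-1%:E * (a1%:E * (\esum_(x in atyp1) row_info P1 x) +
              a2%:E * (\esum_(x in atyp2) row_info P2 x)))%E.
Proof.
have r1 (x : A) : (0 <= row_info P1 x)%E by exact: row_info_ge0.
have r2 (x : A) : (0 <= row_info P2 x)%E by exact: row_info_ge0.
have h0 (x : A) : (0 <= hbar P e x + L%:E)%E by rewrite adde_ge0 ?hbar_ge0.
have := Hs_eps_component_le _ _ _ _ _ _ _ src1 src2 a1_gt0 a2_gt0 a12 n _ _ _
  eta_ge0 L_ge0 e_gt0 eeta_lt1.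
have := Hs_eps_component_le _ _ _ _ _ _ _ src2 src1 a2_gt0 a1_gt0 a21 n _ _ _
  eta_ge0 L_ge0 e_gt0 eeta_lt1.
rewrite [mixture a2 _ _ _]mixtureC => le2 le1; apply: (le_trans (leeD le1 le2)).
rewrite addeACA ge0_muleDr; last 2 first.
- by rewrite mule_ge0 ?esum_ge0// lee_fin ltW.
- by rewrite mule_ge0 ?esum_ge0// lee_fin ltW.
rewrite leeD2r// -Hs_eps_shift// -esumD => [|x _|x _]; last 2 first.
- by rewrite mule_ge0// lee_fin mulr_ge0// ltW.
- by rewrite mule_ge0// lee_fin mulr_ge0// ltW.
apply: le_esum => x _; rewrite margX_mixture// EFinD ge0_muleDl//.
- by rewrite lee_fin mulr_ge0// ltW.
- by rewrite lee_fin mulr_ge0// ltW.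
Qed.

End mixture_bounds.

(** * Asymptotics *)

Section uniform_integrability.
Context (R : realType) (X Y : countType) (P : source R X Y).
Hypotheses (srcP : is_source P) (uiP : uniformly_integrable P).

Let src_ge0 n z : 0 <= P n z. Proof. by have [+ _] := srcP n; apply. Qed.

(** Uniform integrability sums over the values of Z_n; grouping pairs by their value turns it into a
    sum over pairs, with one threshold for all [n]. *)
Lemma uniformly_integrable_tail (d : R) : 0 < d ->
  exists2 u : R, 0 <= u & forall n,
    (\esum_(z in [set z | (0 < P n z)%R /\ (u <= `|Zn P z|)%R]) (P n z * `|Zn P z|)%:E
      <= d%:E)%E.
Proof.
move=> d0; have d0E : (0 < d%:E)%E by rewrite lte_fin.
have : \forall u \near +oo, (ereal_sup (range (fun n : nat =>
      \esum_(z in [set z : R | (u <= `|z|)%R]) (PZ P n z * (`|z|)%:E))) < d%:E)%E.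
  exact: (uiP _ (open_ereal_lt' d0E)).
move=> [M [Mreal MP]]; exists (`|M| + 1); first by rewrite addr_ge0.
have MM : M < `|M| + 1 by rewrite (le_lt_trans (ler_norm M))// ltrDl.
move=> n; have /ltW := MP _ MM.
apply: le_trans; apply: (le_trans _ (ereal_sup_ubound (imageT _ n))) => /=.
set u := `|M| + 1.
pose J (t : R) := [set z | 0 < P n z /\ Zn P z = t].
have f0 z : (0 <= (P n z * `|Zn P z|)%:E)%E by rewrite lee_fin mulr_ge0.
apply: (@le_trans _ _ (\esum_(t in [set t | (u <= `|t|)%R])
    \esum_(z in J t) (P n z * `|Zn P z|)%:E)%E).
  rewrite esum_esum//; rewrite le_eqVlt; apply/orP; left; apply/eqP; symmetry.
  apply: (@reindex_esum _ _ _ _ _ (fun z => (Zn P z, z))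
    (fun k => (P n k.2 * `|Zn P k.2|)%:E)).
  split; first by move=> z [].
    by move=> z z' _ _ [].
  by move=> [t z] [/= ut [Pz Zt]]; exists z; rewrite ?Zt//; split=> //; rewrite Zt.
apply: le_esum => t _.
rewrite /PZ muleC -esumZl// => [|z]; last by rewrite lee_fin.
by apply: le_esum => z [_ <-]; rewrite -EFinM mulrC.
Qed.

(** Truncation: the density is [n] times Z_n, and Z_n is either at most [u] or counted in the tail
    of mass at most [d]. Hence sets of small probability carry little entropy, uniformly in [n]. *)
Lemma row_info_uniform (d : R) : 0 < d ->
  exists2 u : R, 0 <= u & forall n (S : set (n.-tuple X)), (0 < n)%N ->
    (\esum_(x in S) row_info P x <=
     n%:R%:E * (u%:E * (\esum_(x in S) (margX P x)%:E) + d%:E))%E.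
Proof.
move=> d0; have [u u0 uP] := uniformly_integrable_tail d d0; exists u => // n S n0.
have n0R : 0 < n%:R :> R by rewrite ltr0n.
set E := [set z | 0 < P n z /\ u <= `|Zn P z|].
have f0 z : (0 <= (P n z * `|Zn P z|)%:E)%E by rewrite lee_fin mulr_ge0.
have P0 z : (0 <= (P n z)%:E)%E by rewrite lee_fin.
pose g z : \bar R := if z \in E then (P n z * `|Zn P z|)%:E else 0%E.
have g0 z : (0 <= g z)%E by rewrite /g; case: ifP.
rewrite /row_info esum_pair => [|x y]; last by rewrite lee_fin mulr_ge0// info_ge0.
have -> : (\esum_(x in S) (margX P x)%:E =
           \esum_(z in [set z | S z.1]) (P n (z.1, z.2))%:E)%E.
  rewrite -(esum_pair _ _ _ _ (fun x y => (P n (x, y))%:E)) => [|x y]; last by [].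
  by apply: eq_esum => x _; rewrite esum_row.
apply: (@le_trans _ _ (\esum_(z in [set z | S z.1])
    (n%:R%:E * (u%:E * (P n (z.1, z.2))%:E + g z)))%E).
  apply: le_esum => -[x y] _ /=; rewrite /g.
  have infoE : log2 (condXY P x y)^-1 = n%:R * Zn P (x, y).
    by rewrite /Zn mulVKf ?gt_eqF.
  have Z0 : 0 <= Zn P (x, y) by rewrite /Zn mulr_ge0 ?invr_ge0 ?ler0n ?info_ge0.
  rewrite infoE mulrCA; case: ifPn => [_|/negP zE].
    rewrite -[(u%:E * _)%E]EFinM -EFinD -EFinM lee_fin ler_wpM2l ?ler0n//.
    by rewrite ger0_norm// lerDr mulr_ge0.
  rewrite adde0 -!EFinM lee_fin ler_wpM2l ?ler0n// [leRHS]mulrC.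
  have [->|PN0] := eqVneq (P n (x, y)) 0; first by rewrite !mul0r.
  rewrite ler_wpM2l// leNgt; apply/negP => uZ; apply: zE; rewrite inE.
  split; first by rewrite lt_neqAle eq_sym PN0 src_ge0.
  by rewrite ger0_norm// ltW.
rewrite esumZl ?ler0n// => [|z]; last by rewrite adde_ge0// mule_ge0.
rewrite lee_wpmul2l ?lee_fin ?ler0n// esumD => [|z _|z _]//; last by rewrite mule_ge0.
rewrite esumZl// leeD2l//.
apply: (le_trans (subset_esum _ _ _ _ _ (@subsetT _ _))).
by rewrite /g -esum_mkcond; exact: uP.
Qed.

End uniform_integrability.

(** * Entropy carried by atypical x *)

Section atypical_rows.
Context (R : realType) (X Y : countType) (a1 a2 : R) (P1 P2 : source R X Y).
Hypotheses (src1 : is_source P1) (src2 : is_source P2).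
Hypotheses (a1_gt0 : 0 < a1) (a2_gt0 : 0 < a2) (a12 : a1 + a2 = 1).
Hypotheses (ui1 : uniformly_integrable P1) (D12 : (0 < Dinf P1 P2)%E).

(** Outside the dominated set the ratio of marginals is below the constant [c], so its normalized
    logarithm falls below any fixed [b > 0] for large [n]. Positivity of [Dinf] supplies a [b] for
    which this event has vanishing probability. *)
Lemma undominated_near (eta r : R) : 0 < eta -> 0 < r ->
  \forall n \near \oo, (\esum_(x in ~` @dominated R X Y a1 a2 P1 P2 n eta)
    (margX P1 x)%:E <= r%:E)%E.
Proof.
move=> eta0 r0; have [_ [b /= Pb <-]] := ereal_sup_gt D12.
rewrite lte_fin => b0.
have r0E : (0 < r%:E)%E by rewrite lte_fin.
have Pr : \forall n \near \oo, (Pr_div P1 P2 b n < r%:E)%E.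
  exact: (Pb _ (open_ereal_lt' r0E)).
set c := a2 / (eta * a1).
have c0 : 0 < c by rewrite divr_gt0// mulr_gt0.
near=> n.
have n0 : 0 < n%:R :> R by rewrite ltr0n; near: n; exact: nbhs_infty_gt.
have nb : log2 c / b <= n%:R by near: n; exact: nbhs_infty_ger.
apply: (@le_trans _ _ (Pr_div P1 P2 b n)); last by apply/ltW; near: n.
apply: subset_esum => x /= /negP; rewrite /dominated /= -ltNge => h.
have m1 : 0 < margX P1 x by exact: margX_gt0.
have m2 : 0 < margX P2 x by exact: margX_gt0.
split => //; rewrite ltr_pdivrMl//.
apply: (@lt_le_trans _ _ (log2 c)); last by rewrite -ler_pdivrMr.
rewrite ltr_log2 ?posrE ?c0 ?divr_gt0// /c ltr_pdivrMr// mulrAC ltr_pdivlMr ?mulr_gt0//.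
by rewrite mulrC -mulrA.
Unshelve. all: by end_near. Qed.

(** The claim covers all [M >= M0] so that both components can later share one [M]. *)
Lemma atypical_info_near (eta r : R) : 0 < eta -> 0 < r ->
  exists2 M0 : R, 0 < M0 & forall M, M0 <= M -> \forall n \near \oo,
    (\esum_(x in ~` @typical R X Y a1 a2 P1 P2 n eta (log2 M)) row_info P1 x
      <= (n%:R * r)%:E)%E.
Proof.
move=> eta0 r0; have r2 : 0 < r / 2 by rewrite divr_gt0.
have [u u0 uP] := row_info_uniform _ _ _ P1 src1 ui1 (r / 2) r2.
(* One [q] is for undominated x, the other for x with too much deviant mass; dividing by [u + 1]
   allows [u = 0]. *)
have [q q0 qE] : exists2 q, 0 < q & u * (q + q) <= r / 2.
  have u1 : 0 < u + 1 by rewrite ltr_wpDl.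
  exists (r / 2 / (u + 1) / 2); first by rewrite !divr_gt0.
  rewrite [leLHS](_ : _ = u * (r / 2) / (u + 1)); last by field; rewrite gt_eqF.
  by rewrite ler_pdivrMr// mulrC ler_wpM2l ?lerDl// ltW.
exists (2 / (a1 * q * eta)); first by rewrite divr_gt0// !mulr_gt0.
move=> M M0M; have M0 : 0 < M by rewrite (lt_le_trans _ M0M)// divr_gt0// !mulr_gt0.
near=> n.
have n0 : (0 < n)%N by near: n; exact: nbhs_infty_gt.
apply: (le_trans (uP _ _ n0)); rewrite [leRHS]EFinM lee_wpmul2l ?lee_fin ?ler0n//.
apply: (@le_trans _ _ (u%:E * (q + q)%:E + (r / 2)%:E)%E).
  rewrite leeD2r// lee_wpmul2l ?lee_fin//.
  apply: (le_trans (atypical_le _ _ _ _ _ _ _ src1 src2 a1_gt0 a2_gt0 a12 n _ _ eta0 M0)).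
  rewrite EFinD leeD//; first by near: n; exact: undominated_near.
  rewrite lee_fin ler_pdivrMr ?mulr_gt0//.
  move: M0M; rewrite ler_pdivrMr ?mulr_gt0// => /le_trans; apply.
  by rewrite le_eqVlt; apply/orP; left; apply/eqP; ring.
rewrite -EFinM -EFinD lee_fin [leRHS](_ : r = r / 2 + r / 2); last by field.
by rewrite lerD2r.
Unshelve. all: by end_near. Qed.

End atypical_rows.

(** * Upper limits and right limits at 0 *)

Section limits.
Context (R : realType).
Local Open Scope ereal_scope.

Lemma le_limn_esup_near (f g : nat -> \bar R) :
  (forall r : R, (0 < r)%R -> \forall n \near \oo, f n <= g n + r%:E) ->
  limn_esup f <= limn_esup g.
Proof.
move=> fg; apply/lee_addgt0Pr => r r0; rewrite /limn_esup !limf_esupE.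
rewrite -leeBlDr//; apply: le_ereal_inf_tmp => _ [V FV <-].
have FVW : \forall n \near \oo, V n /\ f n <= g n + r%:E.
  by apply: filterI => //; exact: fg.
rewrite leeBlDr//.
apply: (@le_trans _ _ (ereal_sup (f @` [set n | V n /\ f n <= g n + r%:E]))).
  by apply: ereal_inf_lbound; exists [set n | V n /\ f n <= g n + r%:E].
apply: ge_ereal_sup => _ [n [Vn /le_trans fgn] <-]; apply: fgn.
by rewrite leeD2r// ereal_sup_ubound//; exists n.
Qed.

(** By monotonicity both limits are suprema over the unit interval, so halving the argument is
    harmless. *)
Lemma lim_at_right0_le (f g : R -> \bar R) :
  {in `]0%R, 1%R[ &, nonincreasing_fun f} ->
  {in `]0%R, 1%R[ &, nonincreasing_fun g} ->
  (forall e : R, (0 < e)%R -> (2 * e < 1)%R -> f (2 * e)%R <= g e) ->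
  lim (f e @[e --> 0%R^'+]) <= lim (g e @[e --> 0%R^'+]).
Proof.
move=> fni gni fg.
have lt01 : (BRight (0%R : R) < BLeft (1%R : R))%O by rewrite bnd_simp.
rewrite (cvg_lim _ (nonincreasing_at_right_cvge _ lt01 fni))//.
rewrite (cvg_lim _ (nonincreasing_at_right_cvge _ lt01 gni))//.
apply: ge_ereal_sup => _ [t /= + <-]; rewrite in_itv/= => /andP[t0 t1].
rewrite (_ : t = 2 * (t / 2))%R; last by field.
apply: (le_trans (fg _ _ _)); [by rewrite divr_gt0|by rewrite mulrC divfK|].
apply: ereal_sup_ubound; exists (t / 2)%R => //=.
by rewrite in_itv/= divr_gt0//= ltr_pdivrMr// (lt_trans t1)// mul1r ltr1n.
Qed.

End limits.

(** Linear growth is what makes the multiplicative loss [1 + eta] in [Hs_eps_mixture_le] an additive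
    error of order [eta * n]. *)
Lemma Hs_eps_linear (R : realType) (X Y : countType) (P : source R X Y) (e : R) :
  is_source P -> uniformly_integrable P -> 0 < e -> e < 1 ->
  exists2 C : R, 0 <= C & forall n, (0 < n)%N -> (Hs_eps P e n <= (n%:R * C)%:E)%E.
Proof.
move=> srcP uiP e0 e1.
have [u u0 uP] := row_info_uniform _ _ _ P srcP uiP 1 ltr01.
have i0 : 0 <= e^-1 by rewrite invr_ge0 ltW.
exists (e^-1 * (u + 1)); first by rewrite mulr_ge0 ?addr_ge0.
move=> n n0; apply: (le_trans (Hs_eps_markov _ _ _ _ _ srcP _ e0 e1)).
rewrite mulrCA EFinM lee_wpmul2l ?lee_fin//; apply: (le_trans (uP _ _ n0)).
by rewrite esum_margX// mule1 -EFinD -EFinM.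
Qed.

(** * Comparison of mixture and components for large lengths *)

Section asymptotics.
Context (R : realType) (X Y : countType) (a1 a2 : R) (P1 P2 : source R X Y).
Hypotheses (src1 : is_source P1) (src2 : is_source P2).
Hypotheses (ui1 : uniformly_integrable P1) (ui2 : uniformly_integrable P2).
Hypotheses (a1_gt0 : 0 < a1) (a2_gt0 : 0 < a2) (a12 : a1 + a2 = 1).
Hypotheses (D12 : (0 < Dinf P1 P2)%E) (D21 : (0 < Dinf P2 P1)%E).
Local Notation P := (mixture a1 a2 P1 P2 : source R X Y).

Let src : is_source P. Proof. exact: is_source_mixture. Qed.
Let a21 : a2 + a1 = 1. Proof. by rewrite addrC. Qed.

Let atypical_near (eta r : R) : 0 < eta -> 0 < r ->
  exists2 L : R, 0 <= L & \forall n \near \oo,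
    (a1%:E * (\esum_(x in ~` @typical R X Y a1 a2 P1 P2 n eta L) row_info P1 x) +
     a2%:E * (\esum_(x in ~` @typical R X Y a2 a1 P2 P1 n eta L) row_info P2 x)
      <= (n%:R * r)%:E)%E.
Proof.
move=> eta0 r0.
have [M1 M1_gt0 M1P] := atypical_info_near _ _ _ _ _ _ _ src1 src2 a1_gt0 a2_gt0
  a12 ui1 D12 _ _ eta0 r0.
have [M2 M2_gt0 M2P] := atypical_info_near _ _ _ _ _ _ _ src2 src1 a2_gt0 a1_gt0
  a21 ui2 D21 _ _ eta0 r0.
(* Above both thresholds, and at least 1 so that [log2 M] is nonnegative. *)
pose M := M1 + M2 + 1.
exists (log2 M); first by apply: log2_ge0; rewrite lerDr addr_ge0// ltW.
have M1M : M1 <= M by rewrite /M -addrA lerDl addr_ge0// ltW.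
have M2M : M2 <= M by rewrite /M addrAC lerDr addr_ge0// ltW.
apply: filterS2 (M1P M M1M) (M2P M M2M) => n le1 le2.
rewrite (_ : (n%:R * r)%:E = (a1%:E * (n%:R * r)%:E + a2%:E * (n%:R * r)%:E)%E); last first.
  by rewrite -!EFinM -EFinD -mulrDl a12 mul1r.
by apply: leeD; apply: lee_wpmul2l => //; rewrite lee_fin ltW.
Qed.

Lemma Hs_eps_mixture_near (e r : R) : 0 < e -> 2 * e < 1 -> 0 < r ->
  \forall n \near \oo, (Hs_eps P (2 * e) n <=
    a1%:E * Hs_eps P1 e n + a2%:E * Hs_eps P2 e n + (n%:R * r)%:E)%E.
Proof.
move=> e0 e1 r0; have e1' : e < 1 by lra.
have [C1 C1_ge0 C1P] := Hs_eps_linear _ _ _ P1 _ src1 ui1 e0 e1'.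
have [C2 C2_ge0 C2P] := Hs_eps_linear _ _ _ P2 _ src2 ui2 e0 e1'.
pose C := a1 * C1 + a2 * C2.
have C0 : 0 <= C by rewrite addr_ge0// mulr_ge0// ltW.
(* The first bound keeps [e + 2 * eta] below [2 * e]; the second limits the multiplicative loss to
   [n * r / 4]. *)
have [eta [eta0 etae etaC]] : exists eta, [/\ 0 < eta, 2 * eta <= e & eta * C <= r / 4].
  have C1' : 0 < C + 1 by rewrite ltr_wpDl.
  have q0 : 0 < r / 4 / (C + 1) by rewrite !divr_gt0.
  exists (Num.min (e / 2) (r / 4 / (C + 1))); split.
  - by rewrite lt_min q0 divr_gt0.
  - by rewrite mulrC -ler_pdivlMr// ge_min lexx.
  - apply: (@le_trans _ _ (r / 4 / (C + 1) * C)).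
      by rewrite ler_wpM2r// ge_min lexx orbT.
    by rewrite mulrAC ler_pdivrMr// ler_wpM2l ?lerDl// divr_ge0// ltW.
(* The factor [e] compensates the [e^-1] of Markov's inequality, leaving [n * r / 4] for the
   atypical x. *)
have er0 : 0 < e * (r / 4) by rewrite mulr_gt0// divr_gt0.
have [L L0 LP] := atypical_near _ _ eta0 er0.
near=> n.
have n0 : (0 < n)%N by near: n; exact: nbhs_infty_gt.
(* The terms independent of [n] are absorbed by the remaining [n * r / 2]. *)
have nK : ((1 + eta) * L + e^-1 * (2 / ln 2)) / (r / 2) <= n%:R.
  by near: n; exact: nbhs_infty_ger.
have eeta1 : e + 2 * eta < 1 by lra.
apply: (@le_trans _ _ (Hs_eps P (e + 2 * eta) n)).
  by apply: Hs_eps_nonincreasing => //; lra.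
apply: (le_trans (Hs_eps_mixture_le _ _ _ _ _ _ _ src1 src2 a1_gt0 a2_gt0 a12 n _ _ _
  (ltW eta0) L0 e0 eeta1)).
have G0 : (0 <= a1%:E * Hs_eps P1 e n + a2%:E * Hs_eps P2 e n)%E.
  by rewrite adde_ge0// mule_ge0 ?Hs_eps_ge0// lee_fin ltW.
have GC : (a1%:E * Hs_eps P1 e n + a2%:E * Hs_eps P2 e n <= (n%:R * C)%:E)%E.
  apply: (@le_trans _ _ (a1%:E * (n%:R * C1)%:E + a2%:E * (n%:R * C2)%:E)%E).
    apply: leeD; apply: lee_wpmul2l; rewrite ?lee_fin ?(ltW a1_gt0) ?(ltW a2_gt0)//.
      exact: C1P.
    exact: C2P.
  by rewrite -!EFinM -EFinD lee_fin /C; lra.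
move: (_ + _)%E G0 GC => [g| |]//; rewrite !lee_fin => g0 gC.
apply: (@le_trans _ _ ((1 + eta)%:E * (g%:E + L%:E) +
    e^-1%:E * ((n%:R * (e * (r / 4)))%:E + (2 / ln 2)%:E))%E).
  rewrite leeD2l// lee_wpmul2l ?lee_fin ?invr_ge0 ?(ltW e0)// leeD2r//.
  by near: n; exact: LP.
rewrite -(EFinD g L) -(EFinD (n%:R * _)) -!EFinM -!EFinD lee_fin.
have gC' : eta * g <= n%:R * (r / 4).
  apply: (@le_trans _ _ (eta * (n%:R * C))); first by rewrite ler_pM2l.
  by rewrite mulrCA ler_wpM2l.
have er : e^-1 * (n%:R * (e * (r / 4))) = n%:R * (r / 4).
  by field; rewrite gt_eqF.
rewrite [e^-1 * (_ + _)]mulrDr er.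
move: nK; rewrite ler_pdivrMr ?divr_gt0//.
by move: gC'; lra.
Unshelve. all: by end_near. Qed.

Lemma Hs_eps_components_near (e r : R) : 0 < e -> 2 * e < 1 -> 0 < r ->
  \forall n \near \oo, (a1%:E * Hs_eps P1 (2 * e) n + a2%:E * Hs_eps P2 (2 * e) n <=
    Hs_eps P e n + (n%:R * r)%:E)%E.
Proof.
move=> e0 e1 r0.
(* With no multiplicative loss in this direction, [eta = e / 2] is small enough and makes
   [e + 2 * eta] equal to [2 * e]. *)
have eta0 : 0 < e / 2 by rewrite divr_gt0.
have er0 : 0 < e * (r / 2) by rewrite mulr_gt0// divr_gt0.
have [L L0 LP] := atypical_near _ _ eta0 er0.
have e2 : e + 2 * (e / 2) = 2 * e by field.
near=> n.
have nK : L / (r / 2) <= n%:R by near: n; exact: nbhs_infty_ger.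
have eeta1 : e + 2 * (e / 2) < 1 by rewrite e2.
have := Hs_eps_components_le _ _ _ _ _ _ _ src1 src2 a1_gt0 a2_gt0 a12 n _ _ _
  (ltW eta0) L0 e0 eeta1.
rewrite e2 => /le_trans; apply; rewrite -addeA leeD2l//.
apply: (@le_trans _ _ (L%:E + e^-1%:E * (n%:R * (e * (r / 2)))%:E)%E).
  rewrite leeD2l// lee_wpmul2l ?lee_fin ?invr_ge0 ?(ltW e0)//.
  by near: n; exact: LP.
rewrite -EFinM -EFinD lee_fin.
have -> : e^-1 * (n%:R * (e * (r / 2))) = n%:R * (r / 2).
  by field; rewrite gt_eqF.
by move: nK; rewrite ler_pdivrMr ?divr_gt0//; lra.
Unshelve. all: by end_near. Qed.

End asymptotics.

Theorem theorem11 (R : realType) (X Y : countType) (P1 P2 : source R X Y)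
  (a1 a2 : R) :
  is_source P1 -> is_source P2 ->
  uniformly_integrable P1 -> uniformly_integrable P2 ->
  0 < a1 -> 0 < a2 -> a1 + a2 = 1 ->
  (0 < Dinf P1 P2)%E -> (0 < Dinf P2 P1)%E ->
  Hs (mixture a1 a2 P1 P2) =
  lim ((limn_esup (fun n : nat =>
          ((a1 / n%:R)%:E * Hs_eps P1 eps n + (a2 / n%:R)%:E * Hs_eps P2 eps n)%E))
        @[eps --> 0^'+]).
Proof.
move=> src1 src2 ui1 ui2 a1_gt0 a2_gt0 a12 D12 D21.
pose P : source R X Y := mixture a1 a2 P1 P2.
have srcP : is_source P by exact: is_source_mixture.
have in01 (s : R) : s \in `]0, 1[ -> s < 1 by rewrite in_itv/= => /andP[].
have le_limn_esup (f g : nat -> \bar R) : (forall n, (f n <= g n)%E) ->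
    (limn_esup f <= limn_esup g)%E.
  move=> fg; apply: le_limn_esup_near => r r0; apply: nearW => n.
  by rewrite -[leLHS]adde0 leeD// lee_fin ltW.
have Fni : {in `]0, 1[ &, nonincreasing_fun
    (fun e : R => limn_esup (fun n => ((n%:R^-1)%:E * Hs_eps P e n)%E))}.
  move=> s t _ /in01 t1 st; apply: le_limn_esup => n.
  by apply: lee_wpmul2l; rewrite ?lee_fin ?invr_ge0//; exact: Hs_eps_nonincreasing.
have Gni : {in `]0, 1[ &, nonincreasing_fun (fun e : R => limn_esup (fun n : nat =>
    ((a1 / n%:R)%:E * Hs_eps P1 e n + (a2 / n%:R)%:E * Hs_eps P2 e n)%E))}.
  move=> s t _ /in01 t1 st; apply: le_limn_esup => n.
  by apply: leeD; (apply: lee_wpmul2l; first by rewrite lee_fin divr_ge0// ltW);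
    exact: Hs_eps_nonincreasing.
(* Distributivity in the extended reals relies on nonnegative summands, hence the condition
   [e < 1]. *)
have normalize (n : nat) (e : R) : e < 1 ->
    ((a1 / n%:R)%:E * Hs_eps P1 e n + (a2 / n%:R)%:E * Hs_eps P2 e n =
     (n%:R^-1)%:E * (a1%:E * Hs_eps P1 e n + a2%:E * Hs_eps P2 e n))%E.
  move=> e1; have := Hs_eps_ge0 _ _ _ P2 n src2 _ e1.
  have := Hs_eps_ge0 _ _ _ P1 n src1 _ e1.
  move: (Hs_eps P1 e n) (Hs_eps P2 e n) => h1 h2 h1_ge0 h2_ge0.
  rewrite ge0_muleDr.
  - by rewrite !muleA -!EFinM (mulrC _ a1) (mulrC _ a2).
  - by rewrite mule_ge0// lee_fin ltW.
  - by rewrite mule_ge0// lee_fin ltW.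
have scale (n : nat) (u v : \bar R) (r : R) : (0 < n)%N -> (0 <= v)%E -> 0 < r ->
    (u <= v + (n%:R * r)%:E)%E ->
    ((n%:R^-1)%:E * u <= (n%:R^-1)%:E * v + r%:E)%E.
  move=> n0 v0 r0; have n0R : 0 < n%:R :> R by rewrite ltr0n.
  have i0 : (0 <= (n%:R^-1)%:E :> \bar R)%E by rewrite lee_fin invr_ge0 ltW.
  move=> /(lee_wpmul2l i0) /le_trans; apply.
  rewrite ge0_muleDr// ?lee_fin ?mulr_ge0 ?(ltW r0)//.
  by rewrite leeD2l// -EFinM mulKf ?gt_eqF.
(* In each direction, monotonicity in epsilon reduces the claim to levels [2 * e] and [e]; there the
   upper limits are compared through an eventual inequality whose error [n * r] becomes [r] after
   division by [n]. *)
apply/eqP; rewrite /Hs eq_le; apply/andP; split;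
  apply: lim_at_right0_le => // e e0 e1;
  (have e1' : e < 1 by lra);
  apply: le_limn_esup_near => r r0; near=> n;
  (have n0 : (0 < n)%N by near: n; exact: nbhs_infty_gt);
  rewrite normalize//; apply: scale => //.
- by apply: adde_ge0; apply: mule_ge0; rewrite ?lee_fin ?(ltW a1_gt0)
    ?(ltW a2_gt0)//; exact: Hs_eps_ge0.
- by near: n; exact: Hs_eps_mixture_near.
- exact: Hs_eps_ge0.
- by near: n; exact: Hs_eps_components_near.
Unshelve. all: by end_near. Qed.
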